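(* Let $m>2$ and let $M$ be a connected $m$-dimensional manifold. Then $M$ is strongly discrete homogeneous if and only if $M$ has at most one end.
   Context: All spaces are assumed metrizable and all maps continuous. An $m$-manifold is a (metrizable) space locally homeomorphic to $\mathbb{R}^m$ (so without boundary). A family $\mathcal{D}$ of subsets of a space $X$ is discrete if each point $x\in X$ has a neighbourhood which intersects at most one set from $\mathcal{D}$. A subset $A\subset X$ is a discrete subset of $X$ if the family of singletons $\{\{a\}: a\in A\}$ is discrete in this sense (so discrete subsets are closed in $X$). A space $X$ is strongly discrete homogeneous if for any two discrete subsets $A$ and $B$ of $X$ and any bijection $f\colon A\to B$, this bijection extends to a homeomorphism of $X$ onto itself. A generalized continuum is a locally compact, $\sigma$-compact, connected, locally connected (metrizable) space; every connected manifold is one. For a generalized continuum $X$, fix compact sets $X_1,X_2,\dots\subset X$ with $X_n\subset \operatorname{int} X_{n+1}$ for all $n$ and $\bigcup_{n} X_n=X$. An end of $X$ (with respect to $\{X_n\}$) is a sequence $\{Y_n\}_{n=1}^\infty$ such that for every $n$ the set $Y_n$ is a non-empty connected component of $X\setminus X_n$ and $Y_{n+1}\subset Y_n$. The set of ends is, up to canonical identification, independent of the choice of $\{X_n\}$. A compact generalized continuum has no ends. *)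

(* Defs.v *)
From HB Require Import structures.
From mathcomp Require Import all_boot all_order all_algebra.
From mathcomp Require Import all_classical all_reals all_analysis.

Set Implicit Arguments.
Unset Strict Implicit.
Unset Printing Implicit Defensive.

Import Order.TTheory GRing.Theory Num.Theory.
Import numFieldNormedType.Exports.

Local Open Scope classical_set_scope.
Local Open Scope ring_scope.

Definition is_metric (R : realType) (T : Type) (d : T -> T -> R) : Prop :=
  [/\ forall x y, 0 <= d x y,
      forall x y, d x y = 0 <-> x = y,
      forall x y, d x y = d y x &
      forall x y z, d x z <= d x y + d y z].

Definition metrizable (R : realType) (T : topologicalType) : Prop :=
  exists2 d : T -> T -> R, is_metric d &
    forall (x : T) (A : set T),
      nbhs x A <-> exists2 e : R, 0 < e & [set y | d x y < e] `<=` A.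

Definition homeomorphic_sets (T U : topologicalType) (A : set T) (B : set U)
    : Prop :=
  exists (f : T -> U) (g : U -> T),
    [/\ set_fun A B f /\ set_fun B A g,
        {in A, cancel f g}, {in B, cancel g f},
        {within A, continuous f} & {within B, continuous g}].

Definition locally_euclidean (R : realType) (m : nat) (T : topologicalType)
    : Prop :=
  forall x : T, exists (U : set T) (V : set 'rV[R]_m),
    [/\ open U, U x, open V & homeomorphic_sets U V].

Definition manifold (R : realType) (m : nat) (T : topologicalType) : Prop :=
  metrizable R T /\ locally_euclidean R m T.

Definition discrete_family (T : topologicalType) (D : set (set T)) : Prop :=
  forall x : T, exists2 U : set T, nbhs x U &
    forall A B, D A -> D B -> A `&` U !=set0 -> B `&` U !=set0 -> A = B.

Definition discrete_subset (T : topologicalType) (A : set T) : Prop :=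
  discrete_family [set [set a] | a in A].

Definition homeomorphism (T U : topologicalType) (h : T -> U) : Prop :=
  continuous h /\
  exists g : U -> T, [/\ cancel h g, cancel g h & continuous g].

(* A bijection from A onto B is represented by a map f : T -> T whose values
   outside A are irrelevant. *)
Definition strongly_discrete_homogeneous (T : topologicalType) : Prop :=
  forall (A B : set T) (f : T -> T),
    discrete_subset A -> discrete_subset B -> set_bij A B f ->
    exists2 h : T -> T, homeomorphism h & {in A, h =1 f}.

(* Sequences are indexed from 0 instead of 1. *)
Definition compact_exhaustion (T : topologicalType) (X : nat -> set T) : Prop :=
  [/\ forall n, compact (X n),
      forall n, X n `<=` (X n.+1)° &
      \bigcup_n X n = [set: T]].

Definition is_component (T : topologicalType) (A C : set T) : Prop :=
  exists2 x, A x & C = connected_component A x.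

Definition ends (T : topologicalType) (X : nat -> set T)
    : set (nat -> set T) :=
  [set Y | forall n, is_component (~` X n) (Y n) /\ Y n.+1 `<=` Y n].

(* For a generalized continuum exhaustions exist, and the number of ends does
   not depend on which one is used. *)
Definition at_most_one_end (T : topologicalType) : Prop :=
  forall X : nat -> set T, compact_exhaustion X ->
    forall Y Z, ends X Y -> ends X Z -> Y = Z.

(* Main.v *)
(** If [M] has two ends, let [y_n] tend to one of them and let [b_n] alternate
    between sequences tending to the two.  A homeomorphism sending each [y_n]
    to [b_n] would map a connected neighbourhood of the first end into the
    complement of a given compact set, yet meet two of its components.

    Conversely, let [M] have at most one end.  For every compact set, points far
    away can be joined in its complement (compactness of an ultrafilter of
    components), and deleting a discrete set does not disconnect a connected
    open set.  So [a] can be moved to [f a] by a compactly supported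
    homeomorphism fixing any given compact set far from [a] and [f a], and all
    other points of [A] and [B].  Locally finite supports alone do not make the
    infinite composition of such moves bijective (points may escape to
    infinity); the moves are therefore arranged in shells of a sparse exhaustion,
    in four classes, so that within one class the supports are pairwise disjoint.
    Moving the points of [A] slightly first reduces to disjoint [A] and [B].  *)

Require Import Defs.
From HB Require Import structures.
From mathcomp Require Import all_boot all_order all_algebra.
From mathcomp Require Import all_classical all_reals all_analysis.
From mathcomp Require Import ring lra zify.

Set Implicit Arguments.
Unset Strict Implicit.
Unset Printing Implicit Defensive.

Import Order.TTheory GRing.Theory Num.Theory.
Import numFieldNormedType.Exports.

Local Open Scope classical_set_scope.
Local Open Scope ring_scope.

(** * Homeomorphisms and disjoint unions of homeomorphisms *)

(** Local constancy makes the part of [A] where [P] holds both relatively open and relatively closed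
    in [A]. This is how reachability is spread over connected sets below. *)
Lemma connected_local_const (T : topologicalType) (A P : set T) :
  connected A ->
  (forall p, A p -> exists2 N, nbhs p N &
     forall x y, A x -> A y -> N x -> N y -> P x -> P y) ->
  forall a b, A a -> A b -> P a -> P b.
Proof.
move=> cA loc a b Aa Ab Pa.
suff /seteqP[_ /(_ b Ab)[]] : A `&` P = A by [].
apply: cA; first by exists a.
- exists (~` A `|` P)°; first exact: open_interior.
  apply/seteqP; split => y [Ay].
    move=> Py; split => //; have [N Ny NP] := loc _ Ay.
    apply: filterS (Ny) => z Nz; have [Az|] := pselect (A z); last by left.
    by right; apply: (NP y z) => //; exact: nbhs_singleton.
  by move=> /interior_subset[//|Py]; split.
- exists (~` (~` A `|` ~` P)°).
    exact/open_closedC/open_interior.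
  apply/seteqP; split => y [Ay].
    by move=> Py; split => // /interior_subset[].
  move=> nI; split => //; apply: contrapT => nPy; apply: nI.
  have [N Ny NP] := loc _ Ay.
  apply: filterS (Ny) => z Nz; have [Az|] := pselect (A z); last by left.
  right => Pz; apply: nPy; apply: (NP z) => //; exact: nbhs_singleton.
Qed.

(** If [P K] failed, the sets [S] such that [P] holds of [K] minus [S] would form a proper filter.
    At a cluster point of it in [K], the local hypothesis puts the complement of a neighbourhood
    into the filter, a contradiction. *)
Lemma compact_ind (T : topologicalType) (K : set T) (P : set T -> Prop) :
  compact K -> P set0 -> (forall A B, P A -> P B -> P (A `|` B)) ->
  (forall A B, A `<=` B -> P B -> P A) ->
  (forall x, K x -> exists2 U, nbhs x U & P U) -> P K.
Proof.
move=> cK P0 PU Psub loc; apply: contrapT => nPK.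
pose F : set_system T := [set S | P (K `\` S)].
have FF : ProperFilter F.
  split; last first.
    split; first by rewrite /F /= setDT.
      by move=> A B; rewrite /F /= setDIr => PA PB; exact: PU.
    by move=> A B AB; apply: Psub => x [Kx nB]; split => // /AB.
  by rewrite /F /= setD0.
have [|p [Kp clp]] := cK F FF; first by rewrite /F /= setDv.
have [U Up PU'] := loc _ Kp.
have FnU : F (~` U).
  by rewrite /F /=; apply: Psub PU' => x [_ /contrapT].
by have [x []] := clp _ _ FnU Up.
Qed.

Section homeomorphisms.
Variable T : topologicalType.
Implicit Types h k : T -> T.

Lemma homeo_id : homeomorphism (@id T).
Proof. by split; [|exists id; split] => // x; exact: cvg_id. Qed.

Lemma homeo_comp h k : homeomorphism h -> homeomorphism k ->
  homeomorphism (h \o k).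
Proof.
move=> [ch [h' [hK h'K ch']]] [ck [k' [kK k'K ck']]]; split.
  by move=> x; apply: continuous_comp; [exact: ck|exact: ch].
exists (k' \o h'); split.
- exact: can_comp.
- exact: can_comp.
- by move=> x; apply: continuous_comp; [exact: ch'|exact: ck'].
Qed.

Lemma homeo_inj h : homeomorphism h -> injective h.
Proof. by move=> [_ [g [/can_inj]]]. Qed.

Lemma homeo_inv h : homeomorphism h ->
  exists g, [/\ homeomorphism g, cancel h g & cancel g h].
Proof.
by move=> [ch [g [hg gh cg]]]; exists g; split => //; split => //; exists h.
Qed.

Hypothesis hT : hausdorff_space T.

Lemma open_moved h : continuous h -> open [set x | h x <> x].
Proof.
move=> ch; rewrite openE => x /= hx.
have := hT; rewrite open_hausdorff => /(_ (h x) x).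
have /eqP hx' := hx; move=> /(_ hx')[[U V] /= [/set_mem Uh /set_mem Vx] [oU oV UV]].
rewrite /interior; near=> y => hy.
have Uy : U (h y) by near: y; exact/ch/open_nbhs_nbhs.
have Vy : V y by near: y; exact/open_nbhs_nbhs.
by move/eqP: UV => /seteqP[/(_ y) + _]; apply; rewrite hy in Uy.
Unshelve. all: end_near. Qed.

Lemma nbhs_forall_lt (x : T) (A : nat -> set T) n :
  (forall i, nbhs x (A i)) -> nbhs x [set y | forall i, (i < n)%N -> A i y].
Proof.
move=> nA; elim: n => [|n IH]; first exact: filterS filterT.
apply: filterS (filterI IH (nA n)) => y [IHy Any] i.
by rewrite ltnS leq_eqVlt => /predU1P[->//|/IHy].
Qed.

Definition disjoint_union_spec (h : nat -> T -> T) (H : T -> T) :=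
  (forall x i, h i x <> x -> H x = h i x) /\
  (forall x, (forall i, h i x = x) -> H x = x).

Lemma disjoint_union_ex (h : nat -> T -> T) :
  (forall i j x, h i x <> x -> h j x <> x -> i = j) ->
  exists H, disjoint_union_spec h H.
Proof.
move=> dis.
suff /choice[H HH] : forall x, exists y, (forall i, h i x <> x -> y = h i x) /\
    ((forall i, h i x = x) -> y = x) by exists H; split => x; have [] := HH x.
move=> x.
have [[i hi]|/forallNP none] := pselect (exists i, h i x <> x).
  by exists (h i x); split => [j hj|/(_ i)//]; rewrite (dis _ _ _ hi hj).
by exists x; split => // i /none.
Qed.

(** Near a moved point [H] agrees with a single [h i], since the set moved by [h i] is open. Near a
    point fixed by all [h i], only finitely many of them act, so finitely many neighbourhoods are
    intersected. *)
Lemma disjoint_union_continuous (h : nat -> T -> T) H :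
  (forall i, continuous (h i)) ->
  (forall x : T, exists2 N, nbhs x N &
     exists n, forall i, (n <= i)%N -> forall y, N y -> h i y = y) ->
  disjoint_union_spec h H -> continuous H.
Proof.
move=> ch lf [Hm Hf] x.
have [[i hi]|/forallNP none] := pselect (exists i, h i x <> x).
  move=> O; rewrite (Hm x i)// => Ox.
  have cO : nbhs x (h i @^-1` O) by exact: ch.
  have Si : nbhs x [set y | h i y <> y].
    by apply: open_nbhs_nbhs; split => //; exact/open_moved/ch.
  by apply: filterS (filterI cO Si) => y [/= Oy hy]; rewrite /= (Hm y i).
have none' i : h i x = x by apply: contrapT; exact: none.
move=> O; rewrite (Hf x)// => Ox.
have [N Nx [n nN]] := lf x.
have Oi i : nbhs x (h i @^-1` O) by apply: ch; rewrite none'.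
apply: filterS (filterI Ox (filterI Nx (nbhs_forall_lt n Oi))).
move=> y [Oy [Ny hOy]].
have [[i hi]|/forallNP noney] := pselect (exists i, h i y <> y).
  rewrite /= (Hm y i)//.
  have [/nN/(_ _ Ny)//|/hOy//] := leqP n i.
by rewrite /= (Hf y)// => i; apply: contrapT; exact: noney.
Qed.

(** The inverses [g i] move exactly the same points as the [h i], so they satisfy the same
    hypotheses and glue to a map [G], which is inverse to [H]. *)
Lemma homeo_disjoint_union (h : nat -> T -> T) :
  (forall i, homeomorphism (h i)) ->
  (forall i j x, h i x <> x -> h j x <> x -> i = j) ->
  (forall x : T, exists2 N, nbhs x N &
     exists n, forall i, (n <= i)%N -> forall y, N y -> h i y = y) ->
  exists2 H, homeomorphism H & disjoint_union_spec h H.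
Proof.
move=> hh dis lf.
have /choice[g hg] : forall i, exists g,
    [/\ homeomorphism g, cancel (h i) g & cancel g (h i)].
  by move=> i; exact: homeo_inv.
have gfix i x : h i x = x -> g i x = x.
  by move=> e; rewrite -{1}e; have [_ ->] := hg i.
have hfix i x : g i x = x -> h i x = x.
  by move=> e; rewrite -{1}e; have [_ _ ->] := hg i.
have disg i j x : g i x <> x -> g j x <> x -> i = j.
  move=> gi gj; apply: (dis _ _ x) => e; [exact: gi (gfix _ _ e)|exact: gj (gfix _ _ e)].
have [H HH] := disjoint_union_ex dis; have [Hm Hf] := HH.
have [G GG] := disjoint_union_ex disg; have [Gm Gf] := GG.
exists H => //; split.
  by apply: (disjoint_union_continuous _ lf HH) => i; have [] := hh i.
exists G; split.
- move=> x; have [[i hi]|/forallNP none] := pselect (exists i, h i x <> x).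
    rewrite (Hm x i)// (Gm _ i); first by have [_ ->] := hg i.
    have [_ -> _] := hg i => e; apply: hi; by rewrite -e.
  have none' i : h i x = x by apply: contrapT; exact: none.
  by rewrite (Hf x)// (Gf x)// => i; exact: gfix.
- move=> x; have [[i hi]|/forallNP none] := pselect (exists i, g i x <> x).
    rewrite (Gm x i)// (Hm _ i); first by have [_ _ ->] := hg i.
    have [_ _ ->] := hg i => e; apply: hi; by rewrite -e.
  have none' i : g i x = x by apply: contrapT; exact: none.
  by rewrite (Gf x)// (Hf x)// => i; exact: hfix.
- apply: (disjoint_union_continuous _ _ GG).
    by move=> i; have [[]] := hg i.
  move=> x; have [N Nx [n nN]] := lf x; exists N => //; exists n => i ni y Ny.
  by apply/gfix/nN.
Qed.

End homeomorphisms.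

(** * Moving points in a normed space *)

Lemma lipschitz_continuous_norm (R : realType) (V W : normedModType R)
    (f : V -> W) (k : R) :
  (forall x y, `|f x - f y| <= k * `|x - y|) -> continuous f.
Proof.
move=> fk x; apply/cvgrPdist_lt => e e0.
have k0 : 0 < `|k| + 1 by rewrite ltr_wpDl.
near=> y.
have xy : `|x - y| < e / (`|k| + 1).
  by near: y; apply: cvgr_dist_lt; [exact: cvg_id|rewrite divr_gt0].
rewrite (le_lt_trans (fk _ _))//.
rewrite ltr_pdivlMr// mulrC in xy.
rewrite (le_lt_trans _ xy)// ler_wpM2r//.
by rewrite (le_trans (ler_norm _))// lerDl.
Unshelve. all: end_near. Qed.

Section bump.
Variables (R : realType) (V : normedModType R) (p y : V) (d : R).
Hypothesis d0 : 0 < d.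
Hypothesis yd : `|y - p| < d.

Let v := y - p.
(** A tent function with peak 1 at [p], vanishing outside the ball of radius [d]. Its Lipschitz
    constant is the inverse of [d], so the displacement [phi z *: v] is Lipschitz with constant
    [c < 1]; hence [h] is injective with Lipschitz inverse. *)
Let phi z : R := Num.max 0 (1 - `|z - p| / d).
Let h z := z + phi z *: v.
Let c := `|v| / d.

Let phi_ge0 z : 0 <= phi z. Proof. by rewrite le_max lexx. Qed.

Let phi_le1 z : phi z <= 1.
Proof. by rewrite ge_max ler01/= gerBl divr_ge0// ltW. Qed.

Let phi_lip z z' : `|phi z - phi z'| <= `|z - z'| / d.
Proof.
have maxl (a b : R) : `|Num.max 0 a - Num.max 0 b| <= `|a - b|.
  have [a0|a0] := leP 0 a; have [b0|b0] := leP 0 b => //.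
  - by rewrite subr0 ger0_norm// ger0_norm ?lerD2l; lra.
  - by rewrite sub0r normrN ger0_norm// ler0_norm; lra.
  - by rewrite subrr normr0.
apply: le_trans (maxl _ _) _.
have -> : 1 - `|z - p| / d - (1 - `|z' - p| / d) = (`|z' - p| - `|z - p|) / d.
  by rewrite mulrBl; ring.
rewrite normrM [`|d^-1|]gtr0_norm ?invr_gt0//.
rewrite ler_pM2r ?invr_gt0// (le_trans (ler_dist_dist _ _))//.
by rewrite opprB addrA subrK distrC.
Qed.

Let c1 : c < 1. Proof. by rewrite ltr_pdivrMr// mul1r. Qed.

Let phi_v z z' : `|(phi z - phi z') *: v| <= c * `|z - z'|.
Proof.
have -> : c * `|z - z'| = `|z - z'| / d * `|v| by rewrite /c; ring.
by rewrite normrZ ler_wpM2r// phi_lip.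
Qed.

Let h_up z z' : `|h z - h z'| <= (1 + c) * `|z - z'|.
Proof.
rewrite /h opprD addrACA -scalerBl mulrDl mul1r.
by rewrite (le_trans (ler_normD _ _))// lerD2l phi_v.
Qed.

Let h_low z z' : (1 - c) * `|z - z'| <= `|h z - h z'|.
Proof.
rewrite /h opprD addrACA -scalerBl mulrBl mul1r.
have := phi_v z z'; set w := (_ *: v).
have : `|z - z'| <= `|z - z' + w| + `|w|.
  by rewrite -{1}[z - z'](addrK w) (le_trans (ler_normB _ _)).
lra.
Qed.

Let h_surj w : exists z, h z = w.
Proof.
(* A preimage of [w] is sought on the line through [w] in direction [v]: [w - t *: v] is one as soon
   as [F t = 0]. As [phi] takes values between 0 and 1, [F 0] is nonnegative and [F 1]
   nonpositive. *)
pose F t : R := phi (w - t *: v) - t.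
have cF : continuous F.
  apply: (@lipschitz_continuous_norm _ _ _ _ (c + 1)) => s t.
  have -> : F s - F t = (phi (w - s *: v) - phi (w - t *: v)) - (s - t).
    by rewrite /F; ring.
  rewrite (le_trans (ler_normB _ _))// mulrDl mul1r lerD2r.
  apply: le_trans (phi_lip _ _) _.
  have -> : w - s *: v - (w - t *: v) = (t - s) *: v.
    by rewrite opprB addrC -addrA addKr scalerBl addrC.
  by rewrite normrZ distrC /c -mulrA mulrC.
have [||t _ Ft] := @IVT R F 0 1 0 ler01.
- exact: continuous_subspaceT.
- rewrite ge_min le_max /F subr0 phi_ge0 /= subr_le0 phi_le1 orbT //.
exists (w - t *: v); rewrite /h.
by move/eqP: Ft; rewrite subr_eq0 => /eqP ->; rewrite subrK.
Qed.

Lemma bump_homeo : exists h : V -> V, [/\ homeomorphism h, h p = y &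
  forall z, d <= `|z - p| -> h z = z].
Proof.
have hinj : injective h.
  move=> z z' e; apply/eqP; rewrite -subr_eq0 -normr_le0.
  have := h_low z z'; rewrite e subrr normr0 pmulr_rle0// subr_gt0//.
have /choice[g hg] := h_surj.
exists h; split.
- split; first exact: lipschitz_continuous_norm h_up.
  exists g; split => //; first by move=> z; apply: hinj; rewrite hg.
  apply: (@lipschitz_continuous_norm _ _ _ _ (1 - c)^-1) => z z'.
  rewrite mulrC ler_pdivlMr ?subr_gt0// mulrC.
  by rewrite (le_trans (h_low _ _))// !hg.
- by rewrite /h /phi subrr normr0 mul0r subr0 max_r// scale1r addrC subrK.
- move=> z dz; rewrite /h /phi max_l ?scale0r ?addr0//.
  by rewrite subr_le0 ler_pdivlMr// mul1r.
Qed.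

End bump.

Lemma convex_connected_component (R : realType) (V : normedModType R) (A : set V) :
  (forall x y t, A x -> A y -> 0 <= t <= 1 -> A (x + t *: (y - x))) ->
  forall x y, A x -> A y -> connected_component A x y.
Proof.
move=> cA x y Ax Ay.
exists ((fun t : R => x + t *: (y - x)) @` `[0, 1]); last first.
  exists 1; first by rewrite /= in_itv/= ler01 lexx.
  by rewrite scale1r addrC subrK.
split.
- exists 0; first by rewrite /= in_itv/= ler01 lexx.
  by rewrite scale0r addr0.
- by move=> _ [t /= t01 <-]; apply: cA => //; rewrite in_itv/= in t01.
- apply: connected_continuous_connected; first exact: segment_connected.
  apply: continuous_subspaceT => t.
  by apply: cvgD; [exact: cvg_cst|apply: cvgZr_tmp; exact: cvg_id].
Qed.

Lemma connected_of_component (T : topologicalType) (A : set T) :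
  (forall x y, A x -> A y -> connected_component A x y) -> connected A.
Proof.
move=> cA; have [[x Ax]|/forallNP none] := pselect (exists x, A x); last first.
  have -> : A = set0 by rewrite -subset0 => x /none.
  exact: connected0.
have -> : A = connected_component A x.
  by apply/seteqP; split; [move=> y; exact: cA|exact: connected_component_sub].
exact: component_connected.
Qed.

(** * Charts *)

Lemma connected_component_subset (T : topologicalType) (A B : set T) x :
  A `<=` B -> connected_component A x `<=` connected_component B x.
Proof.
move=> AB y [C [Cx CA cC] Cy]; exists C => //; split => //.
exact: subset_trans AB.
Qed.

(** * Balls and punctured balls in Euclidean space *)

Section row_vectors.
Variables (R : realType) (m : nat).
Implicit Types (c z w : 'rV[R]_m) (e : R).

Lemma rV_norm_lt w e : 0 < e -> (forall j, `|w ord0 j| < e) -> `|w| < e.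
Proof.
move=> e0 we; rewrite [ltLHS]/Num.norm/= mx_normrE.
by apply/bigmax_ltP; split => // -[i j] _ /=; rewrite ord1.
Qed.

Lemma ball_convex c e z z' t :
  `|z - c| < e -> `|z' - c| < e -> 0 <= t <= 1 ->
  `|z + t *: (z' - z) - c| < e.
Proof.
move=> ze ze' /andP[t0 t1].
have -> : z + t *: (z' - z) - c = (1 - t) *: (z - c) + t *: (z' - c).
  by apply/rowP => j; rewrite !mxE; ring.
apply: le_lt_trans (ler_normD _ _) _; rewrite !normrZ !ger0_norm ?subr_ge0//.
have [->|tn0] := eqVneq t 0; first by rewrite subr0 mul1r mul0r addr0.
have tp : 0 < t by rewrite lt_neqAle eq_sym tn0.
have : t * `|z' - c| < t * e by rewrite ltr_pM2l.
have : (1 - t) * `|z - c| <= (1 - t) * e by rewrite ler_wpM2l ?subr_ge0// ltW.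
lra.
Qed.

Lemma connected_ball_rV c e : connected [set z | `|z - c| < e].
Proof.
apply: connected_of_component => x y xe ye.
by apply: convex_connected_component => // *; exact: ball_convex.
Qed.

Hypothesis m1 : (1 < m)%N.

(** The punctured ball is the union of the convex half balls [half s i], on which coordinate [i]
    relative to [c] has the sign of [s]. All are linked to the corner point [pt one], which lies in
    every positive half ball. *)
Lemma connected_punctured_ball_rV c e :
  connected [set z | `|z - c| < e /\ z <> c].
Proof.
have [e0|e0] := leP e 0.
  rewrite (_ : mkset _ = set0); first exact: connected0.
  rewrite -subset0 => z [ze _]; have := normr_ge0 (z - c); lra.
set S := mkset _.
pose half (s : R) i := [set z | `|z - c| < e /\ 0 < s * (z - c) ord0 i].
have half_conn s i x y : half s i x -> half s i y -> connected_component S x y.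
  move=> xh yh; apply: (@connected_component_subset _ (half s i)).
    move=> z [ze zi]; split => // zc.
    by move: zi; rewrite zc subrr mxE mulr0 ltxx.
  apply: convex_connected_component => // {xh yh} {}x {}y t [xe xi] [ye yi] t01.
  split; first exact: ball_convex.
  have -> : s * (x + t *: (y - x) - c) ord0 i =
     (1 - t) * (s * (x - c) ord0 i) + t * (s * (y - c) ord0 i).
    by rewrite !mxE; ring.
  move: xi yi; set a := s * _; set b := s * _ => a0 b0.
  have [->|tn0] := eqVneq t 0; first by rewrite subr0 mul1r mul0r addr0.
  case/andP: t01 => t0 t1; have tp : 0 < t by rewrite lt_neqAle eq_sym tn0.
  have tb : 0 < t * b by rewrite mulr_gt0.
  by apply: lt_le_trans tb _; rewrite lerDr mulr_ge0 ?subr_ge0// ltW.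
pose pt (s : 'I_m -> R) := c + \row_j (s j * (e / 2)).
have pt_half (s : 'I_m -> R) i : (forall j, `|s j| = 1) -> half (s i) i (pt s).
  move=> s1; rewrite /half/= /pt addrAC subrr add0r; split.
    apply: rV_norm_lt => // j; rewrite mxE normrM s1 mul1r gtr0_norm; lra.
  have := s1 i; rewrite mxE mulrA; case: (ltrgtP (s i) 0) => s0.
  - by rewrite ltr0_norm// => /eqP; rewrite eqr_oppLR => /eqP->; lra.
  - by rewrite gtr0_norm// => ->; lra.
  - by rewrite s0 normr0 => /eqP; rewrite eq_sym oner_eq0.
pose one := (fun _ : 'I_m => 1 : R).
have one1 j : `|one j| = 1 by rewrite normr1.
have key z : S z -> connected_component S (pt one) z.
  move=> [ze zc].
  have [i zi] : exists i, (z - c) ord0 i != 0.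
    apply: contrapT => /forallNP none; apply: zc; apply/rowP => i.
    have := none i; move/negP; rewrite negbK !mxE subr_eq0 => /eqP//.
  have [zi_gt|zi_lt|/eqP] := ltrgtP ((z - c) ord0 i) 0; last by rewrite (negbTE zi).
    (* The corner [pt s] with only coordinate [i] negative lies in the negative half ball of [i]
       and, for any other coordinate [j], in the positive half ball of [j]. Such a [j] exists
       because [1 < m]. *)
    pose s := (fun j : 'I_m => if j == i then -1 else 1 : R).
    have s1 j : `|s j| = 1 by rewrite /s; case: ifP; rewrite ?normrN normr1.
    have [j ji] : exists j : 'I_m, j != i.
      have [i0|i0] := eqVneq (i : nat) 0%N.
        by exists (Ordinal m1); rewrite -(inj_eq val_inj) /= i0.
      by exists (Ordinal (ltnW m1)); rewrite -(inj_eq val_inj) /= eq_sym.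
    apply: (@connected_component_trans _ _ (pt s)).
      apply: (half_conn 1 j); first exact: (pt_half one).
      by have := pt_half s j s1; rewrite {1}/s (negbTE ji).
    apply: (half_conn (-1) i).
      by have := pt_half s i s1; rewrite {1}/s eqxx.
    by split => //; rewrite mulN1r oppr_gt0.
  apply: (half_conn 1 i); first exact: (pt_half one).
  by split => //; rewrite mul1r.
apply: connected_of_component => x y Sx Sy.
apply: (@connected_component_trans _ _ (pt one)); last exact: key.
by apply: connected_component_sym; exact: key.
Qed.

End row_vectors.

Definition movable (T : topologicalType) (W : set T) (x y : T) :=
  exists h : T -> T, [/\ homeomorphism h, h x = y &
    exists K : set T, [/\ compact K, K `<=` W & forall z, ~ K z -> h z = z]].

Section charts.
Variables (R : realType) (m : nat) (M : topologicalType).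
Hypothesis leM : locally_euclidean R m M.

(** The closed ball of radius [e] is kept inside [V] because its image under [g] will serve as a
    compact neighbourhood and as a compact support. *)
Lemma chart_in (W : set M) (p : M) : open W -> W p ->
  exists (U : set M) (V : set 'rV[R]_m) (f : M -> 'rV[R]_m) (g : 'rV[R]_m -> M) (e : R),
  [/\ [/\ open U, U p & U `<=` W],
      [/\ open V, 0 < e & forall z, `|z - f p| <= e -> V z],
      [/\ forall x, U x -> V (f x), forall z, V z -> U (g z),
        forall x, U x -> g (f x) = x & forall z, V z -> f (g z) = z] &
      (forall x, U x -> f @ x --> f x) /\ (forall z, V z -> g @ z --> g z)].
Proof.
move=> oW Wp.
have [U [V [oU Up oV [f [g [[fUV gVU] fg gf cf cg]]]]]] := leM p.
have {}cf x : U x -> f @ x --> f x.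
  by move=> Ux; move: cf; rewrite continuous_open_subspace// => /(_ x (mem_set Ux)).
have {}cg x : V x -> g @ x --> g x.
  by move=> Ux; move: cg; rewrite continuous_open_subspace// => /(_ x (mem_set Ux)).
have oV' : open (V `&` g @^-1` W).
  by apply: (continuous_inP g oV).1 => // z /set_mem; exact: cg.
have Vp : (V `&` g @^-1` W) (f p).
  by split; [exact: fUV|rewrite /= fg ?inE].
have : nbhs (f p) (V `&` g @^-1` W) by exact: open_nbhs_nbhs.
move=> /nbhs_ballP[e /= e0 eV].
exists (U `&` W), (V `&` g @^-1` W), f, g, (e / 2); split.
- by split; [exact: openI|split|move=> x []].
- split => //; first by rewrite divr_gt0.
  move=> z ze; apply: eV; rewrite -ball_normE /= distrC; lra.
- split.
  + by move=> x [Ux Wx]; split; [exact: fUV|rewrite /= fg ?inE].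
  + by move=> z [Vz Wz]; split => //; exact: gVU.
  + by move=> x [Ux _]; rewrite fg ?inE.
  + by move=> z [Vz _]; rewrite gf ?inE.
- by split => [x [Ux _]|z [Vz _]]; [exact: cf|exact: cg].
Qed.

Lemma closed_ball_rV_compact (c : 'rV[R]_m) (e : R) : 0 < e ->
  compact [set z | `|z - c| <= e].
Proof.
move=> e0; have -> : [set z | `|z - c| <= e] = closed_ball c e.
  by rewrite closed_ballE//; apply/seteqP; split => z /=; rewrite /closed_ball_ /= distrC.
apply: bounded_closed_compact; last exact: closed_ball_closed.
exists (`|c| + e); split; first exact: num_real.
move=> x xe z; rewrite closed_ballE// /closed_ball_ /= => ze.
apply: le_trans (ltW xe).
rewrite -[z](subrK c) addrC (le_trans (ler_normD _ _))// lerD2l distrC//.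
Qed.

Lemma within_at (T U : topologicalType) (f : T -> U) (A B : set T) :
  A `<=` B -> (forall x, B x -> f @ x --> f x) -> {within A, continuous f}.
Proof.
move=> AB cf; apply: continuous_in_subspaceT => x /set_mem Ax.
exact/cf/AB.
Qed.

Lemma compact_nbhs (W : set M) (p : M) : open W -> W p ->
  exists K, [/\ compact K, nbhs p K & K `<=` W].
Proof.
move=> oW Wp.
have [U [V [f [g [e [[oU Up UW] [oV e0 eV] [fUV gVU fK gK] [cf cg]]]]]]] :=
  chart_in oW Wp.
exists (g @` [set z | `|z - f p| <= e]); split.
- apply: continuous_compact; last exact: closed_ball_rV_compact.
  exact: within_at cg.
- have : nbhs p (f @^-1` ball (f p) e) by apply: cf => //; exact: nbhsx_ballx.
  move=> /(filterI (open_nbhs_nbhs (conj oU Up))).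
  apply: filterS => x [Ux]; rewrite /= -ball_normE /= distrC => /ltW xe.
  by exists (f x) => //; rewrite fK.
- by move=> _ [z /eV Vz <-]; exact/UW/gVU.
Qed.

Lemma connected_nbhs (W : set M) (p : M) : (1 < m)%N -> open W -> W p ->
  exists B, [/\ open B, B p, B `<=` W, connected B & connected (B `\ p)] /\
    exists2 q, B q & q <> p.
Proof.
move=> m1 oW Wp.
have [U [V [f [g [e [[oU Up UW] [oV e0 eV] [fUV gVU fK gK] [cf cg]]]]]]] :=
  chart_in oW Wp.
have ltV z : `|z - f p| < e -> V z by move=> /ltW/eV.
(* Rewriting the image under [g] as a preimage under [f] shows that it is open in [M], with no
   appeal to invariance of domain. *)
have BE : g @` [set z | `|z - f p| < e] = U `&` f @^-1` ball (f p) e.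
  apply/seteqP; split => [_ [z /= ze <-]|x [Ux]]; last first.
    rewrite /= -ball_normE /= distrC => xe.
    by exists (f x) => //; rewrite fK.
  split; first exact/gVU/ltV.
  by rewrite /= gK; [rewrite -ball_normE /= distrC|exact: ltV].
exists (g @` [set z | `|z - f p| < e]); split; [split|].
- rewrite BE; apply: (continuous_inP f oU).1; last exact: ball_open.
  by move=> x /set_mem; exact: cf.
- by exists (f p); rewrite /= ?subrr ?normr0 ?fK.
- by move=> _ [z /ltV Vz <-]; exact/UW/gVU.
- apply: connected_continuous_connected; first exact: connected_ball_rV.
  exact: within_at cg.
- have -> : g @` [set z | `|z - f p| < e] `\ p =
            g @` [set z | `|z - f p| < e /\ z <> f p].
    apply/seteqP; split => [_ [[z ze <-] np]|_ [z [ze np] <-]].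
      by exists z => //; split => // zp; apply: np; rewrite /= zp fK.
    by split; [exists z|move=> /= gz; apply: np; rewrite -gz gK//; exact: ltV].
  apply: connected_continuous_connected.
    exact: connected_punctured_ball_rV.
  by apply: within_at cg => z [/ltV].
- pose w := f p + const_mx (e / 2).
  have we : `|w - f p| < e.
    rewrite /w addrAC subrr add0r; apply: rV_norm_lt => // j.
    rewrite mxE gtr0_norm; lra.
  exists (g w); first by exists w.
  move=> gw; have : f (g w) = f p by rewrite gw.
  rewrite gK; last exact: ltV.
  move=> /rowP /(_ (Ordinal (ltnW m1))); rewrite !mxE; lra.
Qed.

Hypothesis hM : hausdorff_space M.

(** Two open sets cover [M]: on [U] the map is a composite of continuous maps, and off the image of
    [C] under [g] it is the identity. That image is compact, hence closed since [M] is Hausdorff. *)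
Lemma chart_transport_continuous (U : set M) (V C : set 'rV[R]_m)
    (f : M -> 'rV[R]_m) (g : 'rV[R]_m -> M) (h : 'rV[R]_m -> 'rV[R]_m) :
  open U ->
  (forall x, U x -> V (f x)) -> (forall z, V z -> U (g z)) ->
  (forall x, U x -> g (f x) = x) ->
  (forall x, U x -> f @ x --> f x) -> (forall z, V z -> g @ z --> g z) ->
  compact C -> C `<=` V -> (forall z, V z -> V (h z)) ->
  continuous h -> (forall z, ~ C z -> h z = z) ->
  continuous (fun x => if pselect (U x) then g (h (f x)) else x).
Proof.
move=> oU fUV gVU fK cf cg cC CV hV ch hC; set F := (F in continuous F).
move=> x; change (F @ x --> F x); have [Ux|nUx] := pselect (U x).
  have cghf : (g \o h \o f) @ x --> (g \o h \o f) x.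
    apply: continuous_comp; first exact: cf.
    by apply: continuous_comp; [exact: ch|exact/cg/hV/fUV].
  have E y : U y -> F y = (g \o h \o f) y.
    by move=> Uy; rewrite /F; case: pselect.
  rewrite E//; apply: cvg_trans cghf; apply: near_eq_cvg.
  by near=> y; rewrite E//; near: y; exact: open_nbhs_nbhs.
have cgC : closed (g @` C).
  apply: compact_closed => //; apply: continuous_compact => //.
  exact: within_at cg.
have ngx : ~ (g @` C) x by move=> [z /CV/gVU + zx]; rewrite zx.
have E y : ~ (g @` C) y -> F y = y.
  rewrite /F; case: pselect => // Uy ng; rewrite hC ?fK// => Cf; apply: ng.
  by exists (f y) => //; exact: fK.
have idx : id @ x --> x by exact: cvg_id.
rewrite E//; apply: cvg_trans idx; apply: near_eq_cvg.
near=> y; rewrite E//; near: y.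
by apply: open_nbhs_nbhs; split => //; exact: closed_openC.
Unshelve. all: end_near. Qed.

Lemma local_move (W : set M) (p : M) : open W -> W p ->
  exists2 N, nbhs p N & forall y, N y -> movable W p y.
Proof.
move=> oW Wp.
have [U [V [f [g [e [[oU Up UW] [oV e0 eV] [fUV gVU fK gK] [cf cg]]]]]]] :=
  chart_in oW Wp.
exists (U `&` f @^-1` ball (f p) e).
  apply: filterI; first exact: open_nbhs_nbhs.
  by apply: cf => //; exact: nbhsx_ballx.
move=> y [Uy]; rewrite /= -ball_normE /= distrC => ye.
have [h [hh hp hfix]] := bump_homeo e0 ye.
have [k [hk kK hK]] := homeo_inv hh.
pose C := [set z | `|z - f p| <= e].
have cC : compact C by exact: closed_ball_rV_compact.
have hC z : ~ C z -> h z = z.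
  by move=> /negP; rewrite -ltNge => /ltW; exact: hfix.
have kC z : ~ C z -> k z = z by move=> nC; rewrite -{1}(hC z nC) kK.
(* If [u z] lies outside [C], then [u] fixes it, and injectivity gives [u z = z]; otherwise [u z]
   lies in [C], inside [V]. *)
have keepV (u : 'rV[R]_m -> 'rV[R]_m) z : injective u ->
    (forall z, ~ C z -> u z = z) -> V z -> V (u z).
  move=> iu uC Vz; have [/eV//|nC] := pselect (C (u z)).
  by have /iu -> := uC _ nC.
have hV z : V z -> V (h z) by apply: keepV => //; exact: homeo_inj.
have kV z : V z -> V (k z) by apply: keepV => //; exact: homeo_inj.
pose lift (u : 'rV[R]_m -> 'rV[R]_m) x := if pselect (U x) then g (u (f x)) else x.
have liftE u x : U x -> lift u x = g (u (f x)).
  by move=> Ux; rewrite /lift; case: pselect.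
have liftN u x : ~ U x -> lift u x = x.
  by move=> Ux; rewrite /lift; case: pselect.
have liftK u u' : (forall z, V z -> V (u z)) -> cancel u u' -> cancel (lift u) (lift u').
  move=> uV uK x; have [Ux|nU] := pselect (U x); last by rewrite !liftN.
  have Vu : V (u (f x)) by exact/uV/fUV.
  by rewrite (liftE _ _ Ux) liftE ?gK ?uK ?fK//; exact: gVU.
exists (lift h); split.
- split.
    exact: (chart_transport_continuous oU fUV gVU fK cf cg cC eV hV hh.1 hC).
  exists (lift k); split; [exact: liftK|exact: liftK|].
  exact: (chart_transport_continuous oU fUV gVU fK cf cg cC eV kV hk.1 kC).
- by rewrite liftE// hp fK.
- exists (g @` C); split.
  + by apply: continuous_compact => //; exact: within_at cg.
  + by move=> _ [z /eV Vz <-]; exact/UW/gVU.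
  + move=> z ng; have [Uz|/liftN//] := pselect (U z).
    rewrite liftE// hC ?fK// => Cf.
    by apply: ng; exists (f z) => //; exact: fK.
Qed.

Lemma component_open (W : set M) (x : M) : (1 < m)%N -> open W ->
  open (connected_component W x).
Proof.
move=> m1 oW; rewrite openE => y cy.
have Wy := connected_component_sub cy.
have [B [[oB By BW cB _] _]] := connected_nbhs m1 oW Wy.
apply: filterS (open_nbhs_nbhs (conj oB By)) => z Bz.
by apply: connected_component_trans cy _; exists B.
Qed.

End charts.

(** * Exhaustion of a connected locally compact metric space *)

Section metric.
Variables (R : realType) (M : topologicalType) (d : M -> M -> R).
Hypothesis md : is_metric d.
Hypothesis nbhsd : forall (x : M) (A : set M),
      nbhs x A <-> exists2 e : R, 0 < e & [set y | d x y < e] `<=` A.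

Let d_ge0 x y : 0 <= d x y. Proof. by case: md. Qed.
Let d0_eq x y : d x y = 0 -> x = y. Proof. by case: md => _ /(_ x y)[+ _]. Qed.
Let dC x y : d x y = d y x. Proof. by case: md. Qed.
Let dtri x y z : d x z <= d x y + d y z. Proof. by case: md. Qed.

Lemma nbhs_metric_ball x e : 0 < e -> nbhs x [set y | d x y < e].
Proof. by move=> e0; apply/nbhsd; exists e. Qed.

Lemma metric_hausdorff : hausdorff_space M.
Proof.
move=> p q clpq; apply/d0_eq/eqP; rewrite eq_le d_ge0 andbT leNgt.
apply/negP => dpq.
have e0 : 0 < d p q / 2 by rewrite divr_gt0.
have [x [/= px qx]] := clpq _ _ (nbhs_metric_ball p e0) (nbhs_metric_ball q e0).
have := dtri p x q; rewrite [d x q]dC; lra.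
Qed.

Hypothesis lcM : forall p : M, exists2 K, nbhs p K & compact K.

(** Radii of closed balls with compact hull, capped at 1 so that the supremum [rad x] is finite.
    This [rad] is positive and 1-Lipschitz, and gives the step length for growing compact sets. *)
Let good x := [set r : R | 0 < r <= 1 /\
  exists2 K, compact K & [set y | d x y <= r] `<=` K].
Let rad x := sup (good x).

Let good_nonempty x : good x !=set0.
Proof.
have [K /nbhsd[e e0 eK] cK] := lcM x.
exists (Num.min (e / 2) 1); split.
  by rewrite lt_min ltr01 ge_min lexx orbT divr_gt0.
exists K => // y /=; rewrite le_min => /andP[ye _]; apply: eK => /=; lra.
Qed.

Let good_sup x : has_sup (good x).
Proof. by split => //; exists 1 => r [/andP[]]. Qed.

Let rad_gt0 x : 0 < rad x.
Proof.
have [r gr] := good_nonempty x; have [/andP[r0 _] _] := gr.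
by apply: lt_le_trans r0 _; apply: ub_le_sup => //; case: (good_sup x).
Qed.

Let rad_le1 x : rad x <= 1.
Proof. by apply: ge_sup => // r [/andP[]]. Qed.

Let rad_compact x s : s < rad x ->
  exists2 K, compact K & [set y | d x y <= s] `<=` K.
Proof.
move=> /(sup_gt (good_nonempty x))[r [_ [K cK rK]] sr].
by exists K => // y /= ys; apply: rK => /=; apply: le_trans ys (ltW sr).
Qed.

Let rad_lip x y : rad x <= rad y + d x y.
Proof.
rewrite leNgt; apply/negP => ltr.
pose s := (rad y + (rad x - d x y)) / 2.
have s1 : rad y < s by rewrite /s; lra.
have s2 : s + d x y < rad x by rewrite /s; lra.
suff : s <= rad y by lra.
apply: ub_le_sup; first by case: (good_sup y).
have r0 := rad_gt0 y; have r1 := rad_le1 x; have d0 := d_ge0 x y.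
split; first by apply/andP; split; lra.
have [K cK sK] := rad_compact s2; exists K => // z /= zs; apply: sK => /=.
by have := dtri x y z; lra.
Qed.

Let compact_step (K : set M) : compact K -> exists2 K', compact K' &
  forall x y, K x -> d x y <= rad x / 2 -> K' y.
Proof.
pose P (S : set M) := exists2 K', compact K' &
  forall x y, S x -> d x y <= rad x / 2 -> K' y.
move=> cK; apply: (@compact_ind _ K P cK).
- by exists set0 => //; exact: compact0.
- move=> A B [K1 cK1 AK1] [K2 cK2 BK2]; exists (K1 `|` K2).
    exact: compactU.
  by move=> x y [Ax|Bx] xy; [left; exact: AK1 xy|right; exact: BK2 xy].
- move=> A B AB [K' cK' BK']; exists K' => // x y /AB; exact: BK'.
- move=> x _; have r0 := rad_gt0 x.
  exists [set y | d x y < rad x / 8]; first by apply: nbhs_metric_ball; lra.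
  (* For [z] within [rad x / 8] of [x], [rad z] is at most [9 / 8 * rad x], so the ball of radius
     [rad z / 2] about [z] stays within [1 / 8 + 9 / 16 = 11 / 16] of [rad x] from [x]. *)
  have [|K' cK' K'E] := @rad_compact x (11 / 16 * rad x); first by lra.
  exists K' => // z y /= xz zy; apply: K'E => /=.
  have := dtri x z y; have := rad_lip z x; rewrite (dC z x); lra.
Qed.

Hypothesis connM : connected [set: M].

Lemma exhaustion_exists : exists2 X : nat -> set M,
  compact_exhaustion X & X 0%N = set0.
Proof.
have [[x0 _]|/forallNP none] := pselect (exists x : M, True); last first.
  exists (fun=> set0) => //; split; first by move=> _; exact: compact0.
  - by move=> n; exact: sub0set.
  - by apply/seteqP; split => // x; have := none x.
have /choice[step stepP] : forall K : set M, exists K', compact K ->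
    compact K' /\ forall x y, K x -> d x y <= rad x / 2 -> K' y.
  move=> K; have [cK|ncK] := pselect (compact K); last by exists set0.
  by have [K' cK' KK'] := compact_step cK; exists K'.
pose E n := iter n step [set x0].
have cE n : compact (E n).
  elim: n => [|n IH]; first exact: compact_set1.
  by have [] := stepP _ IH.
have ES n x y : E n x -> d x y <= rad x / 2 -> E n.+1 y.
  by have [_] := stepP _ (cE n); exact.
(* The index is shifted to put the empty set at 0, so that every point first enters the exhaustion
   at a positive index. *)
exists (fun n => if n is k.+1 then E k else set0) => //; split.
- by case=> [|n] //; exact: compact0.
- case=> [|n] x //= Ex; apply/nbhsd; exists (rad x / 2).
    by have := rad_gt0 x; lra.
  by move=> y /= /ltW; exact: ES Ex.
- apply/seteqP; split => // x _.
  suff [n En] : (\bigcup_n E n) x by exists n.+1.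
  (* The union of the [E n] is clopen: two points [y], [z] within [rad p / 8] of [p] are less than
     [rad p / 4] apart, while [rad y / 2] is at least [7 / 16 * rad p], so [y] in [E n] forces [z]
     in [E n.+1]. *)
  apply: (connected_local_const (P := \bigcup_n E n) connM _ (a := x0)) => //.
    move=> p _; have r0 := rad_gt0 p.
    exists [set y | d p y < rad p / 8]; first by apply: nbhs_metric_ball; lra.
    move=> y z _ _ /= py pz [n _ En]; exists n.+1 => //; apply: ES En _.
    have := dtri y p z; have := rad_lip p y; rewrite (dC y p); lra.
  by exists 0%N.
Qed.

Lemma isolating_radius (D : set M) x :
  (forall K, compact K -> finite_set (D `&` K)) ->
  exists2 r, 0 < r & forall y, D y -> d x y < r -> y = x.
Proof.
move=> lfD; have [K /nbhsd[e e0 eK] cK] := lcM x.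
have /finite_seqP[s sE] := lfD K cK.
have : exists2 r, 0 < r & forall y, y \in s -> d x y < r -> y = x.
  elim: s {sE} => [|a s [r r0 rs]]; first by exists 1.
  have [->|ax] := pselect (a = x).
    exists r => // y; rewrite in_cons => /predU1P[//|]; exact: rs.
  have dxa : 0 < d x a.
    by rewrite lt_neqAle d_ge0 andbT; apply/eqP => /esym/d0_eq/esym.
  exists (Num.min r (d x a)); first by rewrite lt_min r0.
  move=> y; rewrite in_cons lt_min => /predU1P[->|ys] /andP[yr ya].
    by move: ya; rewrite ltxx.
  exact: rs.
move=> [r r0 rs]; exists (Num.min r e); first by rewrite lt_min r0.
move=> y Dy; rewrite lt_min => /andP[yr ye]; apply: rs => //.
have : (D `&` K) y by split => //; exact: eK.
by rewrite sE.
Qed.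

End metric.

(** * Ends *)

Section exhaustions.
Variables (T : topologicalType) (X : nat -> set T).
Hypothesis hT : hausdorff_space T.
Hypothesis exX : compact_exhaustion X.

Lemma exhaustion_mono n k : (n <= k)%N -> X n `<=` X k.
Proof.
have [_ Xint _] := exX.
elim: k => [|k IH]; first by rewrite leqn0 => /eqP ->.
rewrite leq_eqVlt ltnS => /predU1P[->//|/IH nk].
by apply: subset_trans nk _; apply: subset_trans (Xint k) _; exact: interior_subset.
Qed.

Lemma exhaustion_mem x : exists n, X n x.
Proof.
have [_ _ XT] := exX; have : (\bigcup_n X n) x by rewrite XT.
by move=> [n _]; exists n.
Qed.

Lemma exhaustion_nbhs (x : T) : exists n, nbhs x (X n).
Proof.
have [n Xn] := exhaustion_mem x; exists n.+1.
by have [_ Xint _] := exX; exact: Xint.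
Qed.

Lemma exhaustion_closed n : closed (X n).
Proof. by apply: compact_closed => //; case: exX. Qed.

Lemma compact_exhausted (K : set T) : compact K -> exists k, K `<=` X k.
Proof.
move=> cK; apply: (compact_ind (P := fun S => exists k, S `<=` X k) cK).
- by exists 0%N.
- move=> A B [k Ak] [l Bl]; exists (maxn k l) => x [/Ak|/Bl]; apply: exhaustion_mono.
    exact: leq_maxl.
  exact: leq_maxr.
- by move=> A B AB [k Bk]; exists k; exact: subset_trans Bk.
- by move=> x _; have [n Xn] := exhaustion_nbhs x; exists (X n) => //; exists n.
Qed.

Lemma discrete_subset_compact (A K : set T) :
  discrete_subset A -> compact K -> finite_set (A `&` K).
Proof.
move=> dA cK; apply: (compact_ind (P := fun S => finite_set (A `&` S)) cK).
- by rewrite setI0.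
- by move=> B C; rewrite setIUr finite_setU.
- by move=> B C BC; apply: sub_finite_set => x [Ax /BC].
- move=> x _; have [U Ux dU] := dA x; exists U => //.
  have [[a [Aa Ua]]|/forallNP none] := pselect (exists a, A a /\ U a); last first.
    by rewrite (_ : _ `&` _ = set0) // -subset0 => a /none.
  apply: (sub_finite_set _ (finite_set1 a)) => b [Ab Ub].
  have : [set b] = [set a].
    apply: dU; [by exists b|by exists a|by exists b|by exists a].
  by move=> <-.
Qed.

Lemma finite_discrete_subset (A : set T) :
  (forall n, finite_set (A `&` X n)) -> discrete_subset A.
Proof.
move=> fA x; have [n Xn] := exhaustion_nbhs x.
pose F := (A `&` X n) `\ x.
have cF : closed F.
  apply: (accessible_finite_set_closed.1 (hausdorff_accessible hT)).
  exact: finite_setD.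
exists (X n `&` ~` F).
  apply: filterI => //; apply: open_nbhs_nbhs; split; first exact: closed_openC.
  by move=> [_ /(_ erefl)].
have single a : A a -> ([set a] `&` (X n `&` ~` F)) !=set0 -> a = x.
  move=> Aa [_ [-> [Xa nF]]]; apply: contrapT => ax; apply: nF; split => //.
by move=> _ _ [a Aa <-] [b Ab <-] /(single _ Aa) -> /(single _ Ab) ->.
Qed.

Lemma escaping_discrete (phi : nat -> nat) (u : nat -> T) :
  {homo phi : i j / (i < j)%N} ->
  (forall i, ~ X (phi i) (u i)) -> discrete_subset (range u).
Proof.
move=> mphi nu; apply: finite_discrete_subset => n.
apply: (@sub_finite_set _ _ (u @` `I_n)); last exact/finite_image/finite_II.
have phi_ge i : (i <= phi i)%N.
  by elim: i => // i IH; apply: leq_ltn_trans IH _; exact: mphi.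
move=> _ [[i _ <-] Xi]; exists i => //=; rewrite ltnNge; apply/negP => ni.
by apply: (nu i); apply: exhaustion_mono Xi; exact: leq_trans ni (phi_ge i).
Qed.

Lemma escaping_injective (phi : nat -> nat) (u : nat -> T) :
  {homo phi : i j / (i < j)%N} ->
  (forall i, ~ X (phi i) (u i)) -> (forall i, X (phi i.+1) (u i)) -> injective u.
Proof.
move=> mphi nu Xu.
have lt i j : (i < j)%N -> u i <> u j.
  move=> ij e; apply: (nu j); rewrite -e; apply: exhaustion_mono (Xu i).
  exact: (homo_leq (@leqnn) leq_trans (fun i => ltnW (mphi _ _ (ltnSn i)))).
move=> i j e; case: (ltngtP i j) => [/lt|/lt|//]; first by rewrite e.
by rewrite e.
Qed.

Lemma end_mono Y n k : ends X Y -> (n <= k)%N -> Y k `<=` Y n.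
Proof.
move=> eY; elim: k => [|k IH]; first by rewrite leqn0 => /eqP ->.
rewrite leq_eqVlt ltnS => /predU1P[->//|/IH nk].
by apply: subset_trans nk; have [] := eY k.
Qed.

Lemma end_component Y n x : ends X Y -> Y n x -> Y n = connected_component (~` X n) x.
Proof.
move=> /(_ n)[[c _ ->] _]; exact: same_connected_component.
Qed.

Lemma end_nonempty Y n : ends X Y -> exists x, Y n x.
Proof.
by move=> /(_ n)[[c Xc ->] _]; exists c; exact: connected_component_refl.
Qed.

Lemma end_sub Y n x : ends X Y -> Y n x -> ~ X n x.
Proof. by move=> /(_ n)[[c Xc ->] _] /connected_component_sub. Qed.

Lemma sdh_one_end : strongly_discrete_homogeneous T ->
  forall Y Z, ends X Y -> ends X Z -> Y = Z.
Proof.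
move=> sdh Y Z eY eZ; apply: contrapT => YZ.
have [N YZN] : exists N, Y N <> Z N.
  apply: contrapT => /forallNP YZ'; apply: YZ; apply/funext => n.
  by apply: contrapT; exact: YZ'.
have /choice[y0 Yy0] : forall n, exists x, Y n x by move=> n; exact: end_nonempty.
have /choice[z0 Zz0] : forall n, exists x, Z n x by move=> n; exact: end_nonempty.
(* The next level already contains the points chosen at the current one, so points chosen at
   successive levels are distinct. *)
have /choice[step stepP] : forall n, exists k, (n < k)%N /\ X k (y0 n) /\ X k (z0 n).
  move=> n; have [k Xk] := exhaustion_mem (y0 n).
  have [l Xl] := exhaustion_mem (z0 n); exists (maxn n.+1 (maxn k l)).
  split; first exact: leq_maxl.
  by split; [apply: exhaustion_mono Xk|apply: exhaustion_mono Xl]; lia.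
pose phi i := iter i step N.
have mphi : {homo phi : i j / (i < j)%N}.
  by apply: homo_ltn; [exact: ltn_trans|move=> i; have [] := stepP (phi i)].
have phi_ge i : (N + i <= phi i)%N.
  elim: i => [|i IH]; first by rewrite addn0.
  by rewrite addnS; apply: leq_ltn_trans IH _; exact: mphi.
pose y i := y0 (phi i); pose z i := z0 (phi i).
pose b i := if odd i then z i else y i.
have ny i : ~ X (phi i) (y i) by exact: end_sub (Yy0 _).
have nz i : ~ X (phi i) (z i) by exact: end_sub (Zz0 _).
have Xy i : X (phi i.+1) (y i) by have [_ []] := stepP (phi i).
have Xz i : X (phi i.+1) (z i) by have [_ []] := stepP (phi i).
have nb i : ~ X (phi i) (b i) by rewrite /b; case: ifP.
have Xb i : X (phi i.+1) (b i) by rewrite /b; case: ifP.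
have iy := escaping_injective mphi ny Xy.
have ib := escaping_injective mphi nb Xb.
have /choice[f fP] : forall x, exists t, forall n, y n = x -> t = b n.
  move=> x; have [[n <-]|/forallNP none] := pselect (exists n, y n = x).
    by exists (b n) => k /iy ->.
  by exists x => n /none.
have fy n : f (y n) = b n by exact: fP.
have [|h [ch [g [hg gh cg]]] hf] := sdh (range y) (range b) f
    (escaping_discrete mphi ny) (escaping_discrete mphi nb).
  split.
  - by move=> _ [n _ <-]; exists n.
  - by move=> _ _ /set_mem[i _ <-] /set_mem[j _ <-]; rewrite !fy => /ib ->.
  - by move=> _ [n _ <-]; exists (y n); [exists n|].
have hy n : h (y n) = b n by rewrite hf ?fy// inE; exists n.
have cXN : compact (g @` X N).
  apply: continuous_compact; last by case: exX.
  exact: continuous_subspaceT.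
(* The preimage of [X N] under [h] lies in [X k], so [h] maps [Y k] off [X N]. Its connected image
   contains [b i] for all [i >= k], of both parities, which joins [Y N] to [Z N] off [X N]. *)
have [k Xk] := compact_exhausted cXN.
have sub : h @` Y k `<=` ~` X N.
  move=> _ [u Yu <-] Xhu; apply: (end_sub eY Yu); apply: Xk.
  by exists (h u).
have conn : connected (h @` Y k).
  apply: connected_continuous_connected; last exact: continuous_subspaceT.
  by have [[c _ ->] _] := eY k; exact: component_connected.
have mem i : (k <= i)%N -> (h @` Y k) (b i).
  move=> ki; exists (y i) => //; apply: (end_mono eY) (Yy0 (phi i)).
  by have := phi_ge i; lia.
have be : b k.*2 = y k.*2 by rewrite /b odd_double.
have bo : b k.*2.+1 = z k.*2.+1 by rewrite /b /= odd_double.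
have YN : Y N (y k.*2) by apply: (end_mono eY) (Yy0 _); have := phi_ge k.*2; lia.
have ZN : Z N (z k.*2.+1) by apply: (end_mono eZ) (Zz0 _); have := phi_ge k.*2.+1; lia.
apply: YZN; rewrite (end_component eY YN) (end_component eZ ZN).
apply: same_connected_component; exists (h @` Y k).
  split => //; rewrite -be; apply: mem; lia.
by rewrite -bo; apply: mem; lia.
Qed.

(** * Components of complements, and ends as ultrafilter limits *)

Hypothesis component_open : forall (W : set T) x, open W ->
  open (connected_component W x).
Hypothesis connT : connected [set: T].

(** If the component misses the frontier of [X n.+1], it misses all of [X n.+1] by connectedness. It
    is then clopen: points interior to [X n.+1] have a neighbourhood disjoint from it, and all other
    points lie off [X n], where components are open. *)
Lemma component_frontier n x : ~ X n.+1 x ->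
  connected_component (~` X n) x = setT \/
  exists q, [/\ connected_component (~` X n) x q, X n.+1 q & ~ (X n.+1)° q].
Proof.
have [_ Xint _] := exX.
move=> Xx; have [|none] := pselect (exists q, [/\ connected_component (~` X n) x q,
   X n.+1 q & ~ (X n.+1)° q]); first by right.
left; set C := connected_component _ _ in none *.
have nXx : (~` X n) x by move=> /Xint/interior_subset.
have oX : open (~` X n) by apply: closed_openC; exact: exhaustion_closed.
have Cx : C x by exact: connected_component_refl.
have CX t : C t -> ~ X n.+1 t.
  move=> Ct; apply: (connected_local_const (P := ~` X n.+1)
    (@component_connected _ _ x) _ Cx Ct) => // p Cp.
  have [pint|pint] := pselect ((X n.+1)° p).
    by exists (X n.+1) => // u v _ _ Xu _ /(_ Xu).
  exists (~` X n.+1) => //; apply: open_nbhs_nbhs; split.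
    by apply: closed_openC; exact: exhaustion_closed.
  by move=> Xp; apply: none; exists p.
apply/seteqP; split => // t _.
apply: (connected_local_const (P := C) connT _ (a := x)) => // p _.
have [pint|pint] := pselect ((X n.+1)° p).
  by exists (X n.+1) => // u v _ _ Xu _ /CX.
have nXp : (~` X n) p by move=> /Xint.
exists (connected_component (~` X n) p).
  apply: open_nbhs_nbhs; split; first exact: component_open.
  exact: connected_component_refl.
move=> u v _ _ pu pv Cu; apply: connected_component_trans Cu _.
exact: connected_component_trans (connected_component_sym pu) pv.
Qed.

(** Unless one component is the whole space, each [s i] off [X n.+1] shares its component with a
    point [r i] of the compact frontier of [X n.+1]. The [r i] cluster along [F] at some [q], whose
    component is open; were it not to contain [F]-almost all [s i], the complementary indices would
    contradict clustering. *)
Lemma ultrafilter_component (F : set_system nat) (UF : UltraFilter F)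
    (s : nat -> T) n : F [set i | ~ X n.+1 (s i)] ->
  exists2 c, ~ X n c & F [set i | connected_component (~` X n) c (s i)].
Proof.
have [cX Xint _] := exX => Fs.
have [[i [Xi iT]]|noT] := pselect (exists i, ~ X n.+1 (s i) /\
    connected_component (~` X n) (s i) = setT).
  exists (s i); first by move=> /Xint/interior_subset.
  by rewrite iT; exact: filterS filterT.
have /choice[r rP] : forall i, exists q, ~ X n.+1 (s i) ->
    [/\ connected_component (~` X n) (s i) q, X n.+1 q & ~ (X n.+1)° q].
  move=> i; have [Xi|Xi] := pselect (X n.+1 (s i)); first by exists (s i).
  have [iT|[q qP]] := component_frontier Xi; last by exists q.
  by exfalso; apply: noT; exists i.
have cK : compact (X n.+1 `&` ~` (X n.+1)°).
  by apply: compact_closedI => //; exact/open_closedC/open_interior.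
have [|q [[Xq nint] clq]] := cK (r @ F) _.
  by rewrite /= /fmap /=; apply: filterS Fs => i /rP[].
have nXq : (~` X n) q by move=> /Xint.
exists q => //.
have [//|FnC] := in_ultra_setVsetC [set i | connected_component (~` X n) q (s i)] UF.
have Cq : nbhs q (connected_component (~` X n) q).
  apply: open_nbhs_nbhs; split; last exact: connected_component_refl.
  by apply: component_open; apply: closed_openC; exact: exhaustion_closed.
have FA : (r @ F) (r @` [set i |
    ~ X n.+1 (s i) /\ ~ connected_component (~` X n) q (s i)]).
  rewrite /= /fmap /=; apply: filterS (filterI Fs FnC) => i [Xi Ci].
  by exists i.
have [_ [[i [Xi nC] <-] Cri]] := clq _ _ FA Cq.
exfalso; apply: nC; apply: connected_component_trans Cri _.
by apply: connected_component_sym; have [] := rP i Xi.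
Qed.

(** The components selected at consecutive levels are nested because two members of [F] have a
    common index, giving a point in both. *)
Lemma ultrafilter_end (F : set_system nat) (UF : UltraFilter F) (s : nat -> T) :
  (forall n, F [set i | ~ X n (s i)]) ->
  exists2 Y, ends X Y & forall n, F [set i | Y n (s i)].
Proof.
have [_ Xint _] := exX => Fs.
have /choice[c cP] : forall n, exists c, ~ X n c /\
    F [set i | connected_component (~` X n) c (s i)].
  by move=> n; have [c ? ?] := ultrafilter_component UF (Fs n.+1); exists c.
exists (fun n => connected_component (~` X n) (c n)); last by move=> n; case: (cP n).
move=> n; have [nXc Fc] := cP n; split; first by exists (c n).
have [nXc' Fc'] := cP n.+1.
have [i [/= ci ci']] := filter_ex (filterI Fc Fc').
move=> t ct; apply: connected_component_trans ci _.
have : connected_component (~` X n.+1) (s i) t.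
  exact: connected_component_trans (connected_component_sym ci') ct.
apply: connected_component_subset.
by apply: subsetC => u /Xint/interior_subset.
Qed.

(** Otherwise there are escaping pairs never joined off [X j]. Along an ultrafilter finer than [\oo]
    both coordinates converge to ends, which coincide, so some pair lies in one component at level
    [j]. *)
Lemma one_end_join : (forall Y Z, ends X Y -> ends X Z -> Y = Z) ->
  forall j, exists k, forall x y, ~ X k x -> ~ X k y ->
    connected_component (~` X j) x y.
Proof.
move=> one j; apply: contrapT => /forallNP nk.
have /choice[s sP] : forall k, exists xy : T * T, [/\ ~ X k xy.1, ~ X k xy.2 &
    ~ connected_component (~` X j) xy.1 xy.2].
  move=> k; apply: contrapT => /forallNP none; apply: (nk k) => x y Xx Xy.
  by apply: contrapT => nxy; apply: (none (x, y)).
have [F [UF Foo]] := @ultraFilterLemma nat \oo _.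
have Fge n : F [set i | (n <= i)%N] by apply: Foo; exact: nbhs_infty_ge.
have [|Y eY FY] := @ultrafilter_end F UF (fun i => (s i).1).
  move=> n; apply: filterS (Fge n) => i /= ni; have [+ _ _] := sP i.
  by apply: contra_not; exact: exhaustion_mono.
have [|Z eZ FZ] := @ultrafilter_end F UF (fun i => (s i).2).
  move=> n; apply: filterS (Fge n) => i /= ni; have [_ + _] := sP i.
  by apply: contra_not; exact: exhaustion_mono.
have [i [/= Yi Zi]] := filter_ex (filterI (FY j) (FZ j)).
have [_ _] := sP i; apply.
by rewrite -(end_component eY Yi) (one _ _ eY eZ).
Qed.

End exhaustions.

(** * Matching disjoint discrete sets *)

Section movable.
Variable T : topologicalType.
Implicit Types (W : set T) (x y z : T).

Lemma movable_refl W x : movable W x x.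
Proof.
exists id; split => //; first exact: homeo_id.
by exists set0; split => //; exact: compact0.
Qed.

Lemma movable_sym W x y : movable W x y -> movable W y x.
Proof.
move=> [h [hh hx [K [cK KW hK]]]]; have [g [hg ghK hgK]] := homeo_inv hh.
exists g; split => //; first by rewrite -hx ghK.
by exists K; split => // z Kz; rewrite -{1}(hK z Kz) ghK.
Qed.

Lemma movable_trans W y x z : movable W x y -> movable W y z -> movable W x z.
Proof.
move=> [h [hh hx [K [cK KW hK]]]] [g [hg gy [L [cL LW gL]]]].
exists (g \o h); split; first exact: homeo_comp; first by rewrite /= hx.
exists (K `|` L); split; first exact: compactU.
- by move=> t [/KW|/LW].
- by move=> t /not_orP[nK nL] /=; rewrite hK ?gL.
Qed.

End movable.

(** * Moving points inside connected open sets while avoiding a discrete set *)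

Section manifold.
Variables (R : realType) (m : nat) (M : topologicalType).
Hypothesis m1 : (1 < m)%N.
Hypothesis leM : locally_euclidean R m M.
Hypothesis hM : hausdorff_space M.

Lemma movable_connected (W S : set M) a b : open W -> S `<=` W ->
  connected S -> S a -> S b -> movable W a b.
Proof.
move=> oW SW cS Sa Sb.
apply: (connected_local_const (P := movable W a) cS _ Sa Sb); last exact: movable_refl.
move=> p /SW Wp; have [N Np Nmov] := local_move leM hM oW Wp.
exists N => // x y _ _ /Nmov px /Nmov py ax.
exact: movable_trans (movable_trans ax (movable_sym px)) py.
Qed.

Lemma locally_finite_isolated (D : set M) (p : M) :
  (forall K, compact K -> finite_set (D `&` K)) ->
  exists2 N, nbhs p N & forall x, N x -> D x -> x = p.
Proof.
move=> lfD; have [K [cK Kp _]] := compact_nbhs leM (@openT M) (I : setT p).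
exists (K `&` ~` ((D `&` K) `\ p)).
  apply: filterI => //; apply: open_nbhs_nbhs; split; last by move=> [_ /(_ erefl)].
  apply: closed_openC; apply: (accessible_finite_set_closed.1 (hausdorff_accessible hM)).
  exact/finite_setD/lfD.
by move=> x [Kx nx] Dx; apply: contrapT => xp; apply: nx; split.
Qed.

Lemma locally_finite_closed (D : set M) :
  (forall K, compact K -> finite_set (D `&` K)) -> closed D.
Proof.
move=> lfD; rewrite -openC openE => p nDp.
have [N Np ND] := locally_finite_isolated p lfD.
by apply: filterS Np => x /ND xp Dx; apply: nDp; rewrite -(xp Dx).
Qed.

Lemma movable_avoiding (U D : set M) a b : open U -> connected U ->
  (forall K, compact K -> finite_set (D `&` K)) ->
  U a -> U b -> ~ D a -> ~ D b -> movable (U `\` D) a b.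
Proof.
move=> oU cU lfD Ua Ub nDa nDb.
have cD := locally_finite_closed lfD.
have oW : open (U `\` D) by rewrite setDE; apply: openI => //; exact: closed_openC.
(* Propagation has to pass through points of [D], which are not reachable themselves, so [P y]
   speaks only of points near [y] off [D]. It is locally constant because a small ball minus its
   centre is connected. *)
pose P (y : M) := exists2 N, nbhs y N & forall q, N q -> ~ D q -> movable (U `\` D) a q.
suff [N Nb /(_ b (nbhs_singleton Nb) nDb)//] : P b.
apply: (connected_local_const (P := P) cU _ Ua Ub); last first.
  by have [N Na Nmov] := local_move leM hM oW (conj Ua nDa); exists N => // q /Nmov.
move=> p Up; have [N0 N0p N0D] := locally_finite_isolated p lfD.
have [||B [[oB Bp BUN cB cBp] _]] := @connected_nbhs _ _ _ leM (U `&` N0°) p m1.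
- by apply: openI => //; exact: open_interior.
- by split.
have BD x : B x -> D x -> x = p by move=> /BUN[_ /interior_subset]; exact: N0D.
have cBD : connected (B `\` D).
  have [Dp|nDp] := pselect (D p).
    rewrite (_ : B `\` D = B `\ p)//; apply/seteqP; split => x [Bx nx]; split => //.
      by move=> xp; apply: nx; rewrite xp.
    by move=> /(BD _ Bx).
  rewrite (_ : B `\` D = B)//; apply/seteqP; split => [x []//|x Bx]; split => //.
  by move=> Dx; apply: nDp; rewrite -(BD _ Bx Dx).
have BDW : B `\` D `<=` U `\` D by move=> x [/BUN[]].
exists B; first exact: open_nbhs_nbhs.
move=> x y _ _ Bx By [N Nx Nmov]; exists B; first exact: open_nbhs_nbhs.
have [q [Nq Bq nDq]] : exists q, [/\ N q, B q & ~ D q].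
  have [Dx|nDx] := pselect (D x); last by exists x; split => //; exact: nbhs_singleton.
  have xp := BD _ Bx Dx; rewrite xp in Nx.
  have [||C [[_ _ CNB _ _] [q Cq qp]]] := @connected_nbhs _ _ _ leM (N° `&` B) p m1.
  - by apply: openI => //; exact: open_interior.
  - by split.
  have [/interior_subset Nq Bq] := CNB _ Cq.
  by exists q; split => // /(BD _ Bq).
move=> t Bt nDt; apply: movable_trans (Nmov q Nq nDq) _.
exact: (movable_connected oW BDW cBD).
Qed.

End manifold.

Lemma finite_uniform_bound (T : Type) (S : set T) (P : T -> nat -> Prop) :
  finite_set S -> (forall x k l, (k <= l)%N -> P x k -> P x l) ->
  (forall x, S x -> exists k, P x k) -> exists k, forall x, S x -> P x k.
Proof.
move=> fS Pm Pex; have /choice[k kP] : forall x, exists k, S x -> P x k.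
  move=> x; have [Sx|nS] := pselect (S x); last by exists 0%N.
  by have [k Pk] := Pex _ Sx; exists k.
have := finite_image k fS => /finite_seqP[s sE].
exists (\max_(i <- s) i)%N => x Sx; apply: Pm (kP x Sx).
have : (k @` S) (k x) by exists x.
by rewrite sE /= => ks; exact: leq_bigmax_seq.
Qed.

(** * Arranging the moves in shells of a sparse exhaustion *)

Section disjoint_case.
Variables (R : realType) (m : nat) (M : topologicalType).
Hypothesis m1 : (1 < m)%N.
Hypothesis leM : locally_euclidean R m M.
Hypothesis hM : hausdorff_space M.
Hypothesis connM : connected [set: M].
Variable X : nat -> set M.
Hypothesis exX : compact_exhaustion X.
Hypothesis X0 : X 0%N = set0.
Hypothesis joinX : forall j, exists k, forall x y, ~ X k x -> ~ X k y ->
    connected_component (~` X j) x y.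
Variables (A B : set M) (f : M -> M).
Hypothesis lfA : forall K, compact K -> finite_set (A `&` K).
Hypothesis lfB : forall K, compact K -> finite_set (B `&` K).
Hypothesis AB : forall x, A x -> ~ B x.
Hypothesis fAB : forall x, A x -> B (f x).
Hypothesis f_inj : forall x y, A x -> A y -> f x = f y -> x = y.

Let D := A `|` B.

Let mover a (j k : nat) := exists h : M -> M, [/\ homeomorphism h, h a = f a,
  forall z, D z -> z <> a -> z <> f a -> h z = z,
  forall z, X j z -> h z = z & forall z, ~ X k z -> h z = z].

Let mover_ex a j : A a -> connected_component (~` X j) a (f a) ->
  exists k, mover a j k.
Proof.
move=> Aa caf; pose D' := D `\` [set a; f a].
have lfD' K : compact K -> finite_set (D' `&` K).
  move=> cK; apply: (@sub_finite_set _ _ ((A `&` K) `|` (B `&` K))).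
    by move=> x [[[Ax|Bx] _] Kx]; [left|right].
  by rewrite finite_setU; split; [exact: lfA|exact: lfB].
pose U := connected_component (~` X j) a.
have oU : open U.
  apply: (component_open leM) => //; apply: closed_openC; exact: exhaustion_closed.
have XUC x : X j x -> ~ U x by move=> Xx /connected_component_sub.
have Xa : (~` X j) a by case: caf => V [Va VX _] _; exact: VX.
have [h [hh ha [K [cK KU hK]]]] : movable (U `\` D') a (f a).
  apply: (movable_avoiding m1 leM hM oU _ lfD') => //.
  - exact: component_connected.
  - exact: connected_component_refl.
  - by move=> [_]; apply; left.
  - by move=> [_]; apply; right.
have [k Kk] := compact_exhausted exX cK.
exists k, h; split => //.
- move=> z Dz za zf; apply: hK => /KU[_]; apply; split => //.
  by move=> [].
- by move=> z /XUC nU; apply: hK => /KU[].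
- by move=> z nX; apply: hK => /Kk.
Qed.

Let mover_mono a j k l : (k <= l)%N -> mover a j k -> mover a j l.
Proof.
move=> kl [h [hh ha hD hj hk]]; exists h; split => // z nX; apply: hk.
by move=> Xz; apply: nX; exact: exhaustion_mono kl _ Xz.
Qed.

Let near_pairs_finite k : finite_set [set a | A a /\ (X k a \/ X k (f a))].
Proof.
have cX : compact (X k) by case: exX.
apply: (@sub_finite_set _ _ ((A `&` X k) `|` (A `&` f @^-1` (B `&` X k)))).
  by move=> a [Aa [Xa|Xf]]; [left|right; split => //; split => //; exact: fAB].
rewrite finite_setU; split; first exact: lfA.
have : finite_set (f @` (A `&` f @^-1` (B `&` X k))).
  apply: sub_finite_set (lfB cX).
  by move=> _ [a [_ +] <-].
rewrite (eq_finite_set (inj_card_eq _))// => x y /set_mem[Ax _] /set_mem[Ay _].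
exact: f_inj.
Qed.

(** What sparseness has to provide: the second clause keeps the two points of a pair at neighbouring
    levels, the third joins them away from the inner compact sets, and the fourth bounds the
    supports from outside. *)
Let step_prop k k' := [/\ (k < k')%N,
  forall a, A a -> X k a \/ X k (f a) -> X k' a /\ X k' (f a),
  forall x y, ~ X k' x -> ~ X k' y -> connected_component (~` X k) x y &
  forall a j, A a -> X k a -> X k (f a) -> (j <= k)%N ->
    connected_component (~` X j) a (f a) -> mover a j k'].

Let step_ex k : exists k', step_prop k k'.
Proof.
have mono := exhaustion_mono exX.
have [k1 k1P] : exists k1, forall a, (A a /\ (X k a \/ X k (f a))) ->
    X k1 a /\ X k1 (f a).
  apply: (finite_uniform_bound (P := fun a l => X l a /\ X l (f a)) (near_pairs_finite k)).
    by move=> x l l' ll' [Xx Xf]; split; [exact: mono ll' _ Xx|exact: mono ll' _ Xf].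
  move=> a _; have [l Xa] := exhaustion_mem exX a.
  have [l' Xf] := exhaustion_mem exX (f a); exists (maxn l l').
  by split; [apply: mono Xa; exact: leq_maxl|apply: mono Xf; exact: leq_maxr].
have [k2 k2P] := joinX k.
have [k3 k3P] : exists k3, forall a, (A a /\ (X k a \/ X k (f a))) ->
    forall j, `I_k.+1 j -> connected_component (~` X j) a (f a) -> mover a j k3.
  apply: (finite_uniform_bound (P := fun a l => forall j, `I_k.+1 j ->
    connected_component (~` X j) a (f a) -> mover a j l) (near_pairs_finite k)).
    by move=> x l l' ll' Pl j jk /(Pl _ jk); exact: mover_mono.
  move=> a [Aa _].
  apply: (finite_uniform_bound (P := fun j l =>
    connected_component (~` X j) a (f a) -> mover a j l) (finite_II k.+1)).
    by move=> j l l' ll' Pl /Pl; exact: mover_mono.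
  move=> j _; have [caf|ncaf] := pselect (connected_component (~` X j) a (f a)).
    by have [l ml] := mover_ex Aa caf; exists l.
  by exists 0%N.
exists (maxn k.+1 (maxn k1 (maxn k2 k3))); split.
- exact: leq_maxl.
- move=> a Aa Xa; have [Xa1 Xf1] := k1P _ (conj Aa Xa).
  by split; [apply: mono Xa1|apply: mono Xf1]; lia.
- by move=> x y nx ny; apply: k2P; [move: nx|move: ny]; apply: contra_not; apply: mono; lia.
- move=> a j Aa Xa _ jk caf; apply: mover_mono (k3P a _ j _ caf); first lia.
    by split => //; left.
  by rewrite /= ltnS.
Qed.

(* After passing to a subsequence of the exhaustion, each pair [(a, f a)] can
   be matched inside a shell [Z i.+3 `\` Z i.-1]. *)
Let shells : exists (Z : nat -> set M) (lev : M -> nat),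
  [/\ [/\ forall i j, (i <= j)%N -> Z i `<=` Z j, forall i, compact (Z i) &
       forall x : M, exists i, nbhs x (Z i)],
      forall a, A a -> Z (lev a).+2 a &
      forall a, A a -> exists h, [/\ homeomorphism h, h a = f a,
        forall z, D z -> z <> a -> z <> f a -> h z = z,
        forall z, Z (lev a).-1 z -> h z = z &
        forall z, ~ Z (lev a).+3 z -> h z = z]].
Proof.
have mono := exhaustion_mono exX.
have /choice[step stepP] := step_ex.
pose phi i := iter i step 0%N.
have mphi i j : (i <= j)%N -> (phi i <= phi j)%N.
  apply: (homo_leq (@leqnn) leq_trans) => {i j}i.
  by have [/ltnW] := stepP (phi i).
have phi_ge i : (i <= phi i)%N.
  by elim: i => // i IH; apply: leq_ltn_trans IH _; have [] := stepP (phi i).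
pose Z i := X (phi i).
have Z0 x : ~ Z 0%N x by rewrite /Z /= X0.
(* [lev a] is the index just before the pair is first met; it exists because [Z 0] is empty. *)
have /choice[lev levP] : forall a, exists i,
    [/\ ~ Z i a, ~ Z i (f a) & Z i.+1 a \/ Z i.+1 (f a)].
  move=> a; have [n Xa] := exhaustion_mem exX a.
  have : exists n, `[< Z n a \/ Z n (f a) >].
    by exists n; apply/asboolP; left; apply: mono Xa.
  move=> ex; case: (ex_minnP ex) => -[|i] /asboolP Zi imin.
    by case: Zi => Zi; case: (Z0 _ Zi).
  have nZi : ~ (Z i a \/ Z i (f a)).
    by move=> /asboolP/imin; rewrite ltnn.
  by exists i; split => // Zia; apply: nZi; [left|right].
exists Z, lev; split.
- split; first by move=> i j ij; exact/mono/mphi.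
  + by have [cX _ _] := exX; move=> i; exact: cX.
  + move=> x; have [n Xn] := exhaustion_nbhs exX x; exists n.
    by apply: filterS Xn; exact: mono.
- move=> a Aa; have [_ _ Za] := levP a.
  by have [_ /(_ a Aa Za)[]] := stepP (phi (lev a).+1).
- move=> a Aa; have [nZa nZf Za] := levP a.
  have [_ /(_ a Aa Za)[Xa Xf] _ _] := stepP (phi (lev a).+1).
  have [_ _ _ mv] := stepP (phi (lev a).+2).
  apply: mv => //; first by apply: mphi; lia.
  (* At level 0 the predecessor is again 0 and [Z 0] is empty, so connectedness of [M] suffices. At
     level [i.+1] both points lie off [Z i.+1] and are joined off [Z i]. *)
  case: (lev a) nZa nZf => [|i] nZa nZf /=.
    by rewrite X0 setC0 connected_component_id.
  by have [_ _ + _] := stepP (phi i); apply.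
Qed.

(** The movers can be composed in any order: each fixes the points of all other pairs, which are
    distinct from its own since [A] and [B] are disjoint and [f] is injective on [A]. *)
Let finite_mover (s : seq M) (P Q : set M) :
  (forall a, a \in s -> A a /\ exists h, [/\ homeomorphism h, h a = f a,
     forall z, D z -> z <> a -> z <> f a -> h z = z,
     forall z, P z -> h z = z & forall z, ~ Q z -> h z = z]) ->
  exists h, [/\ homeomorphism h, forall a, a \in s -> h a = f a,
     forall z, D z -> (forall a, a \in s -> z <> a /\ z <> f a) -> h z = z,
     forall z, P z -> h z = z & forall z, ~ Q z -> h z = z].
Proof.
elim: s => [_|a s IH sP]; first by exists id; split => //; exact: homeo_id.
have [|h [hh hs hD hP hQ]] := IH; first by move=> b bs; apply: sP; rewrite in_cons bs orbT.
have [as_|nas] := boolP (a \in s).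
  exists h; split => //.
    by move=> b; rewrite in_cons => /predU1P[->|]; exact: hs.
  move=> z Dz zs; apply: hD => // b bs; apply: zs.
  by rewrite in_cons bs orbT.
have [Aa [g [hg ga gD gP gQ]]] := sP a (mem_head _ _).
have sA b : b \in s -> A b by move=> bs; case: (sP b); rewrite ?in_cons ?bs ?orbT.
exists (g \o h); split; first exact: homeo_comp.
- move=> b; rewrite in_cons => /predU1P[->|bs] /=.
    rewrite hD //; first by left.
    move=> c cs; split; first by move=> ac; rewrite ac cs in nas.
    by move=> ac; apply: (AB Aa); rewrite ac; exact/fAB/sA.
  rewrite hs// gD//; first by right; exact/fAB/sA.
    by move=> fba; apply: (AB Aa); rewrite -fba; exact/fAB/sA.
  by move=> /(f_inj (sA _ bs) Aa) ba; rewrite -ba bs in nas.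
- move=> z Dz zs /=; rewrite hD//.
    by have [za zf] := zs a (mem_head _ _); exact: gD.
  by move=> b bs; apply: zs; rewrite in_cons bs orbT.
- by move=> z Pz /=; rewrite hP ?gP.
- by move=> z Qz /=; rewrite hQ ?gQ.
Qed.

Lemma match_disjoint : exists2 h, homeomorphism h & forall a, A a -> h a = f a.
Proof.
have [Z [lev [[Zmono cZ nbZ] Zlev mv]]] := shells.
have /choice[h hP] : forall i, exists h : M -> M, [/\ homeomorphism h,
     forall a, A a -> lev a = i -> h a = f a,
     forall z, D z -> (forall a, A a -> lev a = i -> z <> a /\ z <> f a) -> h z = z,
     forall z, Z i.-1 z -> h z = z & forall z, ~ Z i.+3 z -> h z = z].
  move=> i; have /finite_seqP[s sE] : finite_set [set a | A a /\ lev a = i].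
    apply: sub_finite_set (lfA (cZ i.+2)) => a [Aa la]; split => //.
    by rewrite -la; exact: Zlev.
  have sP a : (a \in s) <-> (A a /\ lev a = i).
    by have /seteqP[+ +] := sE => /(_ a) + /(_ a).
  have [|h [hh ha hD hP hQ]] := @finite_mover s (Z i.-1) (Z i.+3).
    by move=> a /sP[Aa <-]; split => //; exact: mv.
  exists h; split => //; first by move=> a Aa la; apply/ha/sP.
  move=> z Dz zs; apply: hD => // a /sP[]; exact: zs.
(* Movers whose levels agree modulo 4 have disjoint supports. *)
pose hc (r i : nat) := if (i %% 4 == r)%N then h i else id.
have hc_moved r i x : hc r i x <> x -> [/\ (i %% 4 = r)%N, ~ Z i.-1 x & Z i.+3 x].
  rewrite /hc; case: eqP => // ir hx; have [_ _ _ hZ hnZ] := hP i.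
  by split => //; [move=> /hZ|apply: contrapT => /hnZ].
(* Congruent levels [i < j] differ by at least 4, so [i.+3 <= j.-1]: the outer bound of one support
   lies in the set fixed by the other. *)
have hc_lt r i j x : (i < j)%N -> hc r i x <> x -> hc r j x <> x -> False.
  move=> ij /hc_moved[ir _ Zi] /hc_moved[jr nZj _]; apply: nZj.
  by apply: Zmono Zi; lia.
have /choice[F FP] : forall r, exists F, homeomorphism F /\ disjoint_union_spec (hc r) F.
  move=> r; have [|||F hF sF] := @homeo_disjoint_union M hM (hc r).
  - by move=> i; rewrite /hc; case: ifP => _; [case: (hP i)|exact: homeo_id].
  - by move=> i j x hi hj; case: (ltngtP i j) => // ij; case: (hc_lt r _ _ x ij).
  - move=> x; have [n Zn] := nbZ x; exists (Z n) => //; exists n.+1 => i ni y Zy.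
    apply: contrapT => /hc_moved[_ + _]; apply; apply: Zmono Zy; lia.
  - by exists F.
have Fmove r a : A a -> (lev a %% 4 = r)%N -> F r a = f a.
  move=> Aa ar; have [_ [Fm _]] := FP r; have [_ ha _ _ _] := hP (lev a).
  have hca : hc r (lev a) a = f a by rewrite /hc ar eqxx ha.
  rewrite (Fm a (lev a)) hca// => fa; apply: (AB Aa); rewrite -fa; exact: fAB.
have Ffix r z : D z -> (forall a, A a -> (lev a %% 4 = r)%N -> z <> a /\ z <> f a) ->
    F r z = z.
  move=> Dz zr; have [_ [_ Ff]] := FP r; apply: Ff => i.
  rewrite /hc; case: eqP => // ir; have [_ _ hD _ _] := hP i.
  by apply: hD => // a Aa la; apply: zr; rewrite ?la.
have FfixA r a : A a -> (lev a %% 4 <> r)%N -> F r a = a.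
  move=> Aa ar; apply: Ffix; first by left.
  move=> b Ab br; split; first by move=> ab; rewrite ab in ar.
  by move=> ab; apply: (AB Aa); rewrite ab; exact: fAB.
have FfixB r a : A a -> (lev a %% 4 <> r)%N -> F r (f a) = f a.
  move=> Aa ar; apply: Ffix; first by right; exact: fAB.
  move=> b Ab br; split; first by move=> ab; apply: (AB Ab); rewrite -ab; exact: fAB.
  by move=> /(f_inj Aa Ab) ab; rewrite ab in ar.
(* Each [F r] carries [a] to [f a] for the levels of class [r] and fixes both points of every other
   pair, so composing the four classes never disturbs a finished or a pending pair. *)
have composite n : exists2 G, homeomorphism G &
    forall a, A a -> G a = if (lev a %% 4 < n)%N then f a else a.
  elim: n => [|r [G hG GP]]; first by exists id => //; exact: homeo_id.
  exists (F r \o G); first by apply: homeo_comp => //; case: (FP r).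
  move=> a Aa /=; rewrite GP//.
  rewrite (_ : (_ < r.+1)%N = (lev a %% 4 == r)%N || (lev a %% 4 < r)%N); last first.
    by rewrite ltnS leq_eqVlt.
  case: (ltngtP (lev a %% 4)%N r) => ar /=.
  - by apply: FfixB => // e; rewrite e ltnn in ar.
  - by apply: FfixA => // e; rewrite e ltnn in ar.
  - exact: Fmove.
by have [G hG GP] := composite 4%N; exists G => // a Aa; rewrite GP// ltn_pmod.
Qed.

End disjoint_case.

(** * General discrete sets *)

Section displacement.
Variables (R : realType) (m : nat) (M : topologicalType) (d : M -> M -> R).
Hypothesis m1 : (1 < m)%N.
Hypothesis leM : locally_euclidean R m M.
Hypothesis md : is_metric d.
Hypothesis nbhsd : forall (x : M) (A : set M),
      nbhs x A <-> exists2 e : R, 0 < e & [set y | d x y < e] `<=` A.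
Variable X : nat -> set M.
Hypothesis exX : compact_exhaustion X.
Hypothesis X0 : X 0%N = set0.

(** Moving [a] by less than half its isolation radius keeps [c] injective and off [D]. Choosing
    [c a] outside the last [X j] that misses [a] ensures that only finitely many [c a] enter a given
    compact set. *)
Lemma displace (A D : set M) : A `<=` D ->
  (forall K, compact K -> finite_set (D `&` K)) ->
  exists c : M -> M, [/\ forall a, A a -> ~ D (c a),
    forall a b, A a -> A b -> c a = c b -> a = b &
    forall K, compact K -> finite_set (c @` A `&` K)].
Proof.
move=> AD lfD; have hM := metric_hausdorff md nbhsd.
have [_ _ dC dtri] := md.
have lcM (p : M) : exists2 K, nbhs p K & compact K.
  by have [K [cK Kp _]] := compact_nbhs leM (@openT M) (I : setT p); exists K.
have /choice[r rP] : forall a, exists r, 0 < r /\ forall y, D y -> d a y < r -> y = a.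
  by move=> a; have [r r0 rD] := isolating_radius md nbhsd lcM a lfD; exists r.
have /choice[c cP] : forall a, exists q, [/\ d a q < r a / 2, q <> a &
    forall k, X k q -> X k a].
  move=> a; have ex : exists n, `[< X n a >].
    by have [n Xn] := exhaustion_mem exX a; exists n; apply/asboolP.
  case: (ex_minnP ex) => -[|j] /asboolP Xj jmin; first by rewrite X0 in Xj.
  have nXj : ~ X j a by move=> /asboolP/jmin; rewrite ltnn.
  have Wa : ([set y | d a y < r a / 2]° `&` ~` X j) a.
    split => //; apply: (nbhs_metric_ball nbhsd).
    by have [r0 _] := rP a; rewrite divr_gt0.
  have oW : open ([set y | d a y < r a / 2]° `&` ~` X j).
    apply: openI; first exact: open_interior.
    by apply: closed_openC; exact: exhaustion_closed.
  have [B [[_ _ BW _ _] [q Bq qa]]] := connected_nbhs leM m1 oW Wa.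
  have [/interior_subset/= dq nXq] := BW _ Bq.
  exists q; split => // k Xk; have [jk|kj] := ltnP j k.
    exact: (exhaustion_mono exX jk).
  by case: nXq; exact: (exhaustion_mono exX kj).
exists c; split.
- move=> a _ Dc; have [dac ca _] := cP a; apply: ca; have [r0 ra] := rP a.
  by apply: ra => //; lra.
- move=> a b Aa Ab cab; have [da _ _] := cP a; have [db _ _] := cP b.
  have [ra0 ra] := rP a; have [rb0 rb] := rP b.
  (* The distance from [a] to [b] is below the mean of [r a] and [r b], hence below the larger,
     whose isolation property identifies the two points. *)
  have := dtri a (c a) b; rewrite {2}cab (dC (c b) b) => tri.
  have [rab|rab] := leP (r a) (r b).
    by apply: rb; [exact: AD|rewrite dC; lra].
  by apply/esym; apply: ra; [exact: AD|lra].
- move=> K /(compact_exhausted exX)[k Kk].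
  apply: (@sub_finite_set _ _ (c @` (D `&` X k))).
    move=> _ [[a Aa <-] /Kk Xc]; exists a => //; split; first exact: AD.
    by have [_ _] := cP a; apply.
  by apply/finite_image/lfD; case: exX.
Qed.

End displacement.

Theorem theorem4p3 (R : realType) (m : nat) (hm : (2 < m)%N)
    (M : topologicalType) (manM : manifold R m M)
    (connM : connected [set: M]) :
  strongly_discrete_homogeneous M <-> at_most_one_end M.
Proof.
have [[d md nbhsd] leM] := manM; have m1 : (1 < m)%N := ltnW hm.
have hM := metric_hausdorff md nbhsd.
split=> [sdh X exX Y Z|one A B f dA dB [fAB finj _]].
  exact: (sdh_one_end hM exX sdh).
have lcM (p : M) : exists2 K, nbhs p K & compact K.
  by have [K [cK Kp _]] := compact_nbhs leM (@openT M) (I : setT p); exists K.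
have [X exX X0] := exhaustion_exists md nbhsd lcM connM.
have join := one_end_join hM exX
  (fun W x => component_open leM x m1) connM (one X exX).
have lfA K : compact K -> finite_set (A `&` K) := discrete_subset_compact dA.
have lfB K : compact K -> finite_set (B `&` K) := discrete_subset_compact dB.
have lfAB K : compact K -> finite_set ((A `|` B) `&` K).
  by move=> cK; rewrite setIUl finite_setU; split; [exact: lfA|exact: lfB].
have [c [cD cinj lfC]] := displace m1 leM md nbhsd exX X0 (@subsetUl _ A B) lfAB.
(* [f] is factored through [c]: [g] sends [c a] to [f a], with an irrelevant value elsewhere. Both
   factors match disjoint locally finite sets, [A] with its image under [c], and that image with
   [B]. *)
have /choice[g gP] : forall x, exists y, forall a, A a -> c a = x -> y = f a.
  move=> x; have [[a [Aa <-]]|none] := pselect (exists a, A a /\ c a = x).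
    by exists (f a) => b Ab /(cinj _ _ Ab Aa) ->.
  by exists x => a Aa cax; exfalso; apply: none; exists a.
have [h1 hh1 h1P] : exists2 h, homeomorphism h & forall a, A a -> h a = c a.
  apply: (match_disjoint m1 leM hM connM exX X0 join lfA lfC) => //.
  by move=> a Aa [b Ab cba]; apply: (cD b Ab); rewrite cba; left.
have [h2 hh2 h2P] : exists2 h, homeomorphism h & forall x, (c @` A) x -> h x = g x.
  apply: (match_disjoint m1 leM hM connM exX X0 join lfC lfB).
  - by move=> _ [a Aa <-] Bc; apply: (cD a Aa); right.
  - by move=> _ [a Aa <-]; rewrite (gP _ a)//; exact: fAB.
  - move=> _ _ [a Aa <-] [b Ab <-]; rewrite (gP _ a)// (gP _ b)// => fab.
    by congr c; apply: finj; rewrite ?inE.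
exists (h2 \o h1); first exact: homeo_comp.
move=> a /set_mem Aa /=; rewrite h1P// h2P; last by exists a.
exact: gP.
Qed.
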